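(* Let $n\ge1$ and let $f(X)=\sum_{i=0}^{n}a_{i}X^{i}$, $g(X)=\sum_{i=0}^{n}b_{i}X^{i}\in\mathbb{Z}[X]$ with $a_{0}a_{n}b_{0}b_{n}\neq 0$. Suppose that $|Res(f,g)|=pq$ with $p$ a prime number and $q$ a positive integer. Suppose also that for two positive real numbers $A,B$ with $B\geq 3A+2q^{1/n}$ we have $|a_{n}|>\sum_{i=0}^{n-1}|a_{i}|A^{i-n}$ and $|b_{0}|>\sum_{i=1}^{n}|b_{i}|B^{i}$. Then the polynomial $Mf(X)+Ng(X)$ is irreducible over $\mathbb{Q}$ for all integers $M$ and $N$ with $$|M|\cdot\frac{|a_n|}{|b_n|}<|N|\leq\frac{B-3A}{2q^{1/n}}.$$
   Context: $Res(f,g)$ is the resultant of $f$ and $g$. *)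

(* Defs.v *)
From HB Require Import structures.
From mathcomp Require Import all_boot all_order all_algebra.
From mathcomp Require Import all_reals exp.

(* Main.v *)
Require Import Defs.
From HB Require Import structures.
From mathcomp Require Import all_boot all_order all_algebra.
From mathcomp Require Import all_reals exp.
From mathcomp Require Import algC.
From mathcomp Require Import complex ring lra zify.

(** Write F = M f + N g, and let c = |N| q^(1/n).

    The domination hypotheses put every root x of f in the disc |x| < A and
    every root y of g outside the disc |y| <= B ([root_lt_of_lead_dominant],
    [root_gt_of_const_dominant]).  At a root z of F the values |M f(z)| and
    |N g(z)| agree, while |M a_n| < |N b_n|; so some root of g is at least as
    close to z as some root of f, and this forces 2|z| > B - A
    ([lincomb_root_far]).  Hence z is at distance greater than
    (B - 3A)/2 >= c >= 1 from each root of f.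

    Let h be a nonconstant integer factor of F.  Up to sign, Res(f, h) is
    lc(h)^n times the product of the f(z) over the roots z of h, and each of
    these factors exceeds c^n = |N|^n q in modulus, so
    |Res(f, h)| > |N|^n q ([resultant_gt_of_far_roots]).  If F = h k with both
    factors nonconstant, then
    |Res(f, h)| |Res(f, k)| = |Res(f, F)| = |N|^n |Res(f, g)| = p (|N|^n q)
    ([norm_resultantM], [norm_resultant_lincomb]).  The prime p divides one
    factor on the left, so the other one is at most |N|^n q: a contradiction.
    Gauss's lemma passes from factors over the rationals to integer factors.

    The product formula for resultants ([resultant_roots]) comes from
    Euclidean division.  Dividing the rows X^i q of the Sylvester matrix by p
    gives Res(p, q) = +/- lc(p)^(deg q) det(multiplication by q modulo p);
    this determinant is multiplicative in q, and for q = X - y it is read off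
    the characteristic polynomial of the companion matrix of p. *)

Set Implicit Arguments.
Unset Strict Implicit.
Unset Printing Implicit Defensive.
Import Order.TTheory GRing.Theory Num.Theory.
Local Open Scope ring_scope.

(** * Multiplication by a polynomial modulo p *)

Section ModularMultiplication.
Variables (F : fieldType) (n : nat) (p : {poly F}).

(** Polynomials of degree less than n are encoded as row vectors; n is kept
    apart from the size of p so that p can be rescaled without changing the
    matrix type. *)
Definition mulmodp (h : {poly F}) (u : 'rV[F]_n) : 'rV[F]_n :=
  poly_rV ((rVpoly u * h) %% p).

Definition muldivp m (h : {poly F}) (u : 'rV[F]_n) : 'rV[F]_m :=
  poly_rV ((rVpoly u * h) %/ p).

Lemma mulmodp_is_linear h : linear (mulmodp h).
Proof.
move=> a u v; rewrite /mulmodp linearP mulrDl -scalerAl modpD modpZl.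
by rewrite linearP.
Qed.

Lemma muldivp_is_linear m h : linear (muldivp m h).
Proof.
move=> a u v; rewrite /muldivp linearP mulrDl -scalerAl divpD divpZl.
by rewrite linearP.
Qed.

HB.instance Definition _ h :=
  GRing.isLinear.Build F 'rV_n 'rV_n _ (mulmodp h) (@mulmodp_is_linear h).

HB.instance Definition _ m h :=
  GRing.isLinear.Build F 'rV_n 'rV_m _ (muldivp m h) (@muldivp_is_linear m h).

Definition mulmod_mx h : 'M[F]_n := lin1_mx (mulmodp h).

Hypothesis size_p : size p = n.+1.

Lemma size_modp_le h : (size (h %% p)%R <= n)%N.
Proof.
have p0 : p != 0 by rewrite -size_poly_eq0 size_p.
by rewrite -ltnS -size_p ltn_modp.
Qed.

Lemma mulmod_mxM g h : mulmod_mx (g * h) = mulmod_mx g *m mulmod_mx h.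
Proof.
apply/row_matrixP=> i; rewrite !rowE mulmxA !mul_rV_lin1 /= /mulmodp.
rewrite poly_rV_K ?size_modp_le //; congr poly_rV.
by rewrite mulrA [in RHS]mulrC modp_mul mulrC.
Qed.

Lemma mulmod_mxC c : mulmod_mx c%:P = c%:M.
Proof.
apply/row_matrixP=> i; rewrite !rowE mul_rV_lin1 /= /mulmodp.
rewrite mulrC mul_polyC modp_small; last first.
  by rewrite size_p ltnS (leq_trans (size_scale_leq _ _)) ?size_poly.
by rewrite linearZ /= rVpolyK mul_mx_scalar.
Qed.

Lemma mulmod_mxD g h : mulmod_mx (g + h) = mulmod_mx g + mulmod_mx h.
Proof.
apply/row_matrixP=> i; rewrite !rowE mulmxDr !mul_rV_lin1 /= /mulmodp.
by rewrite mulrDr modpD linearD.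
Qed.

End ModularMultiplication.

Lemma char_poly_det (R : comNzRingType) n (M : 'M[R]_n) a :
  (char_poly M).[a] = \det (a%:M - M).
Proof.
rewrite horner_sum; apply: eq_bigr => s _.
rewrite hornerM horner_exp !hornerE; congr (_ * _).
rewrite (big_morph _ (fun p q => hornerM p q a) (hornerC 1 a)).
by apply: eq_bigr => i _; rewrite !mxE !(hornerE, hornerMn).
Qed.

(** The row of X^i only wraps around for the top power, where X^d is replaced
    by X^d - p: these are the rows of the companion matrix. *)
Lemma mulmod_mxX (F : fieldType) (p : {poly F}) : p \is monic ->
  mulmod_mx (size p).-1 p 'X = companionmx p.
Proof.
move=> pm; have p0 := monic_neq0 pm.
apply/matrixP=> i j; rewrite !mxE /= /mulmodp rVpoly_delta -exprSr.
move: (nat_of_ord i) (nat_of_ord j) (ltn_ord i) (ltn_ord j) => {i j} i j.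
have: size p = (size p).-1.+1 by rewrite prednK // size_poly_gt0.
move: (size p).-1 => d sp lt_id lt_jd.
have [iE|iN] := eqVneq; last first.
  by rewrite modp_small ?coefXn 1?eq_sym // size_polyXn sp; lia.
have -> : i.+1 = d by rewrite iE prednK // (leq_trans _ lt_id).
have -> : 'X^d %% p = 'X^d - p.
  rewrite -[in LHS](subrK p 'X^d) modpD modpp addr0 modp_small //.
  rewrite [X in (_ < X)%N]sp ltnS; apply/leq_sizeP => k.
  rewrite leq_eqVlt coefB coefXn => /orP[/eqP<-|lt].
    by rewrite eqxx -(monicP pm) lead_coefE sp subrr.
  by rewrite gtn_eqF // nth_default ?subrr // sp.
by rewrite coefB coefXn ltn_eqF // sub0r.
Qed.

(** For monic p this determinant is, up to sign, the characteristic polynomial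
    of the companion matrix at y, that is p(y); the general case follows since
    rescaling p does not change remainders. *)
Lemma det_mulmod_XsubC (F : fieldType) n (p : {poly F}) y : size p = n.+1 ->
  exists e : nat, \det (mulmod_mx n p ('X - y%:P)) =
     (-1) ^+ e * ((lead_coef p)^-1 * p.[y]).
Proof.
move=> sp; have p0 : p != 0 by rewrite -size_poly_eq0 sp.
pose r := (lead_coef p)^-1 *: p.
have rm : r \is monic by rewrite monicE lead_coefZ mulVf ?lead_coef_eq0.
have c0 : (lead_coef p)^-1 != 0 by rewrite invr_eq0 lead_coef_eq0.
have -> : mulmod_mx n p ('X - y%:P) = mulmod_mx n r ('X - y%:P).
  by apply/matrixP=> i j; rewrite !mxE /mulmodp /r modpZr.
have sr : size r = n.+1 by rewrite size_scale.
have <- : r.[y] = (lead_coef p)^-1 * p.[y] by rewrite hornerZ.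
have {sp p0 c0} nE : n = (size r).-1 by rewrite sr.
exists n; clearbody r; subst n.
rewrite mulmod_mxD -polyCN (mulmod_mxC sr) (mulmod_mxX rm) raddfN /=.
by rewrite -[X in \det X]opprB -scaleN1r detZ -char_poly_det companionmxK.
Qed.

(** * Resultants as products of values at roots *)

Section Euclid.
Variables (F : fieldType) (p : {poly F}) (n : nat).
Hypothesis size_p : size p = n.+1.

(** The change of basis from p, X p, ..., X^(m-1) p, 1, X, ..., X^(n-1) to the
    powers of X.  The multiples of p come first, as in the Sylvester matrix. *)
Definition shift_mx m : 'M[F]_(m + n) := \matrix_(i, j)
  if (i < m)%N then p`_(j - i) *+ (i <= j) else ((i - m)%N == j :> nat)%:R.

(** The last column has a single nonzero entry, the leading coefficient of
    X^(m-1) p; deleting its row and column leaves the same matrix for m - 1. *)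
Lemma det_shift_mx m :
  exists e : nat, \det (shift_mx m) = (-1) ^+ e * lead_coef p ^+ m.
Proof.
elim: m => [|m [e IH]].
  exists 0%N; rewrite mul1r -[RHS](det1 F n); congr (\det _).
  by apply/matrixP=> i j; rewrite !mxE subn0.
exists (m + (m + n) + e)%N.
have mlt : (m < (m + n).+1)%N by rewrite ltnS leq_addr.
rewrite (expand_det_col (shift_mx m.+1 : 'M[F]_((m + n).+1)) ord_max).
rewrite (bigD1 (Ordinal mlt)) //= big1 => [|i].
  rewrite addr0 /cofactor !mxE /= ltnSn addKn leq_addr mulr1n.
  have -> : row' (Ordinal mlt) (col' ord_max (shift_mx m.+1 : 'M[F]_((m + n).+1))) = shift_mx m.
    apply/matrixP=> i j; rewrite !mxE lift_max /= /bump.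
    by have [im|im] := leqP m i; rewrite ?add0n ?add1n ltnS ?ltnNge ?im ?subSS // ltnW.
  by rewrite IH !exprD exprS lead_coefE size_p /=; ring.
rewrite -val_eqE /= => im; rewrite !mxE /=.
have [lt|ge] := ltnP i m.+1.
  rewrite nth_default ?mul0rn ?mul0r // size_p.
  by rewrite ltn_subRL; rewrite ltnS leq_eqVlt (negPf im) /= in lt; rewrite ltn_add2r.
rewrite (_ : _ == _ = false) ?mul0r //; apply/eqP => E.
move: (ltn_ord i) => /= h.
by move: (nat_of_ord i) E ge h => k /= E ge h; clear -E ge h; lia.
Qed.

Lemma shift_mxE m : shift_mx m =
  col_mx (lin1_mx (poly_rV \o p \o* rVpoly)) (lin1_mx (poly_rV \o rVpoly)).
Proof.
apply/matrixP=> i j; rewrite !mxE; case: splitP => k -> /=; rewrite !mxE /=.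
  by rewrite rVpoly_delta coefXnM ltnNge if_neg -mulrb.
by rewrite rVpoly_delta coefXn addKn eq_sym.
Qed.

(** Dividing X^i q by p factors the Sylvester matrix as a block triangular
    matrix, with the quotients below the identity and the remainders as last
    diagonal block, times [shift_mx]. *)
Lemma resultant_mulmod (q : {poly F}) m : size q = m.+1 ->
  resultant p q = \det (mulmod_mx n p q) * \det (shift_mx m).
Proof.
move=> sq; rewrite /resultant /Sylvester_mx size_p sq /=.
have p0 : p != 0 by rewrite -size_poly_eq0 size_p.
rewrite -[\det (mulmod_mx _ _ _)]mul1r -{1}(det1 F m) -(det_lblock _ (lin1_mx (muldivp p m q))).
rewrite -det_mulmx shift_mxE mul_block_col mul1mx mul0mx addr0.
congr (\det (col_mx _ _)); apply/row_matrixP => i.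
rewrite !rowE mulmxDr !mulmxA !mul_rV_lin1 /= /muldivp /mulmodp.
rewrite !poly_rV_K ?size_modp_le //.
  by rewrite [in LHS](divp_eq (rVpoly _ * q) p) linearD.
rewrite size_divp // size_p /= leq_subLR.
apply: leq_trans (size_polyMleq _ _) _; rewrite sq addnS /= addnC addnC leq_add2r.
exact: size_poly.
Qed.

End Euclid.

(** The sign is left unspecified throughout, as only absolute values of
    resultants matter below. *)
Lemma resultant_roots (F : fieldType) (p q : {poly F}) (s : seq F) :
  (1 < size p)%N -> q = lead_coef q *: \prod_(y <- s) ('X - y%:P) -> q != 0 ->
  exists e : nat, resultant p q =
    (-1) ^+ e * (lead_coef q ^+ (size p).-1 * \prod_(y <- s) p.[y]).
Proof.
move=> sp qE q0; have c0 : lead_coef q != 0 by rewrite lead_coef_eq0.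
have {}sp : size p = (size p).-1.+1 by rewrite prednK // ltnW.
have lp0 : lead_coef p != 0 by rewrite lead_coef_eq0 -size_poly_eq0 sp.
have sq : size q = (size s).+1 by rewrite qE size_scale // size_prod_XsubC.
rewrite (resultant_mulmod sp sq).
have [e1 ->] := det_shift_mx sp (size s).
have [e2 E2] : exists e : nat, \det (mulmod_mx (size p).-1 p (\prod_(y <- s) ('X - y%:P))) =
   (-1) ^+ e * ((lead_coef p ^+ size s)^-1 * \prod_(y <- s) p.[y]).
  elim: s {qE sq} => [|y s [e2 IH]].
    by exists 0%N; rewrite !big_nil (mulmod_mxC sp) det1 expr0 invr1 !mul1r.
  have [e3 E3] := det_mulmod_XsubC y sp.
  exists (e3 + e2)%N; rewrite !big_cons (mulmod_mxM sp) det_mulmx IH E3 exprD exprS invfM.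
  by ring.
exists (e1 + e2)%N; rewrite {1}qE -mul_polyC (mulmod_mxM sp) (mulmod_mxC sp).
rewrite det_mulmx det_scalar E2 exprD; field.
by rewrite expf_neq0.
Qed.

Lemma map_resultant_inj (aR rR : nzRingType) (f : {rmorphism aR -> rR})
    (p q : {poly aR}) : injective f ->
  f (resultant p q) = resultant (map_poly f p) (map_poly f q).
Proof.
move=> inj_f; rewrite /resultant /Sylvester_mx.
rewrite !(size_map_inj_poly inj_f) ?rmorph0 // -det_map_mx /= map_col_mx.
congr (\det (col_mx _ _));
  by apply: map_lin1_mx => v; rewrite map_poly_rV rmorphM /= map_rVpoly.
Qed.

Lemma resultant_intr (K : numDomainType) (p q : {poly int}) :
  (resultant p q)%:~R = resultant (map_poly intr p) (map_poly intr q) :> K.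
Proof. by apply: map_resultant_inj; exact: intr_inj. Qed.

Section RootsOfTheLeftArgument.
Variable F : closedFieldType.
Implicit Types (p q : {poly F}) (s : seq F).

Lemma horner_roots p s z :
  p = lead_coef p *: \prod_(x <- s) ('X - x%:P) ->
  p.[z] = lead_coef p * \prod_(x <- s) (z - x).
Proof.
move=> {1}->; rewrite hornerZ horner_prod.
by congr (_ * _); apply: eq_bigr => x _; rewrite hornerXsubC.
Qed.

Lemma size_roots p s : p != 0 ->
  p = lead_coef p *: \prod_(x <- s) ('X - x%:P) -> size s = (size p).-1.
Proof.
by move=> p0 {1}->; rewrite size_scale ?lead_coef_eq0 // size_prod_XsubC.
Qed.

(** Both this and [resultant_roots] are expansions of the product of all the
    differences of a root of p and a root of q, weighted by powers of the two
    leading coefficients. *)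
Lemma resultant_rootsl p q s : (1 < size p)%N ->
  p = lead_coef p *: \prod_(x <- s) ('X - x%:P) -> q != 0 ->
  exists e : nat, resultant p q =
    (-1) ^+ e * (lead_coef p ^+ (size q).-1 * \prod_(x <- s) q.[x]).
Proof.
move=> sp pE q0; have [t qE] := closed_field_poly_normal q.
have p0 : p != 0 by rewrite -size_poly_gt0 ltnW.
have [e ->] := resultant_roots sp qE q0; exists (e + size t * size s)%N.
under eq_bigr do rewrite (horner_roots _ pE).
under [in RHS]eq_bigr do rewrite (horner_roots _ qE).
rewrite !big_split /= !big_const_seq !count_predT !iter_mulr_1.
rewrite (size_roots p0 pE) (size_roots q0 qE) exprD -!mulrA; congr (_ * _).
rewrite exchange_big /=.
under eq_bigr do under eq_bigr do rewrite -opprB -mulN1r.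
under eq_bigr do rewrite big_split /= big_const_seq count_predT iter_mulr_1.
rewrite big_split /= big_const_seq count_predT iter_mulr_1 -exprM.
by rewrite (size_roots p0 pE) (size_roots q0 qE); ring.
Qed.

End RootsOfTheLeftArgument.

(** * Absolute values of resultants of integer polynomials *)

Lemma norm_resultant_intl (f h : {poly int}) (s : seq algC) : (1 < size f)%N ->
  map_poly intr f = (lead_coef f)%:~R *: \prod_(x <- s) ('X - x%:P) -> h != 0 ->
  (`|resultant f h|%:~R : algC) =
    `|(lead_coef f)%:~R| ^+ (size h).-1 * \prod_(x <- s) `|(map_poly intr h).[x]|.
Proof.
have I : injective (intr : int -> algC) by exact: intr_inj.
move=> sf fE h0; rewrite intr_norm resultant_intr.
have sm (u : {poly int}) : size (map_poly intr u : {poly algC}) = size u.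
  by rewrite (size_map_inj_poly I) ?rmorph0.
have [|||e ->] := resultant_rootsl _ _ (s := s) (q := map_poly intr h) (p := map_poly intr f).
- by rewrite sm.
- by rewrite lead_coef_map_inj.
- by rewrite -size_poly_eq0 sm size_poly_eq0.
by rewrite normrMsign normrM normrX normr_prod sm lead_coef_map_inj.
Qed.

(** Evaluating the second argument at the roots of f is multiplicative, and
    the exponent of lc(f) is a degree, hence additive. *)
Lemma norm_resultantM (f g h : {poly int}) : (1 < size f)%N -> g * h != 0 ->
  `|resultant f (g * h)| = `|resultant f g| * `|resultant f h|.
Proof.
move=> sf; rewrite mulf_eq0 negb_or => /andP[g0 h0].
have I : injective (intr : int -> algC) by exact: intr_inj.
have [s sE] := closed_field_poly_normal (map_poly intr f : {poly algC}).
rewrite lead_coef_map_inj // in sE; apply: I.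
rewrite rmorphM /= !(norm_resultant_intl sf sE) ?mulf_neq0 // size_mul //.
have -> : (size g + size h).-1.-1 = ((size g).-1 + (size h).-1)%N.
  move: g0 h0; rewrite -!size_poly_gt0; case: (size g) => // a _; case: (size h) => // b _.
  by rewrite addSn addnS.
under eq_bigr do rewrite rmorphM hornerM normrM.
by rewrite big_split exprD /=; ring.
Qed.

(** At each root of f the combination takes N times the value of g.  The
    degree hypothesis makes the powers of lc(f) agree on the two sides. *)
Lemma norm_resultant_lincomb (f g : {poly int}) (M N : int) : (1 < size f)%N ->
  size (M *: f + N *: g) = size g -> N != 0 -> g != 0 ->
  `|resultant f (M *: f + N *: g)| = `|N| ^+ (size f).-1 * `|resultant f g|.
Proof.
move=> sf sz N0 g0.
have I : injective (intr : int -> algC) by exact: intr_inj.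
have [s sE] := closed_field_poly_normal (map_poly intr f : {poly algC}).
have f0 : f != 0 by rewrite -size_poly_gt0 ltnW.
have sm : size (map_poly intr f : {poly algC}) = size f.
  by rewrite (size_map_inj_poly I) ?rmorph0.
have ss : size s = (size f).-1.
  by rewrite (size_roots _ sE) -?size_poly_eq0 sm // size_poly_eq0.
have rs x : x \in s -> (map_poly intr f).[x] = 0.
  by move=> xs; apply/rootP; rewrite sE rootZ ?root_prod_XsubC // lead_coef_eq0 -size_poly_eq0 sm size_poly_eq0.
rewrite lead_coef_map_inj // in sE; apply: I.
rewrite rmorphM rmorphXn /= !(norm_resultant_intl sf sE) //; last first.
  by rewrite -size_poly_eq0 sz size_poly_eq0.
rewrite sz mulrCA; congr (_ * _).
rewrite -ss -iter_mulr_1 -count_predT -big_const_seq -big_split /=.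
rewrite big_seq [RHS]big_seq; apply: eq_bigr => x /rs fx.
by rewrite rmorphD /= !map_polyZ hornerD !hornerZ fx mulr0 add0r normrM intr_norm.
Qed.

(** * Location of complex roots *)

Import ComplexField.
Import Normc.

Section ComplexModulus.
Variable R : rcfType.
Implicit Types (z : R[i]).

Lemma normc_ge0 z : 0 <= normc z.
Proof. by case: z => x y; exact: sqrtr_ge0. Qed.

Lemma normcX z k : normc (z ^+ k) = normc z ^+ k.
Proof. by elim: k => [|k IH]; rewrite ?normc1 // !exprS normcM IH. Qed.

Lemma normc_prod (I : Type) (s : seq I) (P : pred I) (E : I -> R[i]) :
  normc (\prod_(i <- s | P i) E i) = \prod_(i <- s | P i) normc (E i).
Proof. exact: (big_morph _ (@normcM R) (normc1 R)). Qed.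

Lemma ler_normc_sum (I : Type) (s : seq I) (P : pred I) (E : I -> R[i]) :
  normc (\sum_(i <- s | P i) E i) <= \sum_(i <- s | P i) normc (E i).
Proof.
elim/big_rec2: _ => [|i x z _ IH]; first by rewrite normc0.
by apply: le_trans (le_normcD _ _) _; rewrite lerD2l.
Qed.

Lemma normc_int (k : int) : normc (k%:~R : R[i]) = `|k|%:~R.
Proof.
have -> : (k%:~R : R[i]) = (k%:~R : R)%:C%C by rewrite rmorph_int.
by rewrite /= expr0n addr0 sqrtr_sqr intr_norm.
Qed.

Lemma normc_distC z w : normc (z - w) = normc (w - z).
Proof. by rewrite -normcN opprB. Qed.

Lemma normc_sign e : normc ((-1) ^+ e : R[i]) = 1.
Proof. by rewrite normcX normcN normc1 expr1n. Qed.

Lemma ltr_prod_seq (T : eqType) (s : seq T) (E : T -> R) c : 0 <= c ->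
  (0 < size s)%N -> (forall x, x \in s -> c < E x) ->
  c ^+ size s < \prod_(x <- s) E x.
Proof.
move=> c0; elim: s => // x [_ _|y s IH _] h.
  by rewrite big_seq1 expr1 h ?mem_head.
rewrite big_cons exprS ltr_pM ?exprn_ge0 //; first by rewrite h ?mem_head.
by apply: IH => // z zs; rewrite h // in_cons zs orbT.
Qed.

Lemma ler_prod_seq (T : eqType) (s : seq T) (E : T -> R) c :
  (forall x, x \in s -> 0 <= E x <= c) ->
  \prod_(x <- s) E x <= c ^+ size s.
Proof.
move=> h; rewrite -iter_mulr_1 -count_predT -big_const_seq big_seq [leRHS]big_seq.
exact: ler_prod.
Qed.

(** For |z| >= A the leading term of f outweighs all the others together. *)
Lemma root_lt_of_lead_dominant n (f : {poly int}) (A : R) z :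
  (size f <= n.+1)%N -> 0 < A ->
  \sum_(0 <= i < n) `|f`_i|%:~R * A ^ (i%:Z - n%:Z) < `|f`_n|%:~R ->
  (map_poly intr f).[z] = 0 -> normc z < A.
Proof.
move=> sf A0 dom; rewrite (horner_coef_wide _ (leq_trans (size_poly _ _) sf)).
rewrite big_ord_recr /= => /eqP; rewrite addrC addr_eq0 => /eqP E.
rewrite ltNge; apply/negP => Az.
have z0 : 0 < normc z by apply: lt_le_trans Az.
move/(congr1 (@normc R)): E; rewrite normcN normcM normcX coef_map /= normc_int.
move=> E; have := ler_normc_sum (index_enum 'I_n) predT
  (fun i => (map_poly intr f)`_i * z ^+ i); rewrite -E => {E}.
apply/negP; rewrite -ltNge.
apply: (@le_lt_trans _ _ ((\sum_(0 <= i < n) `|f`_i|%:~R * A ^ (i%:Z - n%:Z)) * normc z ^+ n)).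
  rewrite big_mkord mulr_suml; apply: ler_sum => i _.
  rewrite normcM normcX coef_map /= normc_int -mulrA.
  have -> : i%:Z - n%:Z = - (n - i)%N%:Z by rewrite -subzn ?opprB // ltnW.
  rewrite ler_wpM2l ?ler0z // -exprnN mulrC ler_pdivlMr ?exprn_gt0 //.
  rewrite -[in leRHS](subnKC (ltnW (ltn_ord i))) exprD ler_wpM2l ?exprn_ge0 ?normc_ge0 //.
  by apply: lerXn2r; rewrite ?nnegrE ?normc_ge0 ?(ltW A0).
by rewrite ltr_pM2r ?exprn_gt0.
Qed.

(** For |z| <= B the constant term of g outweighs all the others together. *)
Lemma root_gt_of_const_dominant n (g : {poly int}) (B : R) z :
  (size g <= n.+1)%N -> 0 < B ->
  \sum_(1 <= i < n.+1) `|g`_i|%:~R * B ^+ i < `|g`_0|%:~R ->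
  (map_poly intr g).[z] = 0 -> B < normc z.
Proof.
move=> sg B0 dom; rewrite (horner_coef_wide _ (leq_trans (size_poly _ _) sg)).
rewrite big_ord_recl /= expr0 mulr1 => /eqP; rewrite addr_eq0 => /eqP E.
rewrite ltNge; apply/negP => zB.
move/(congr1 (@normc R)): E; rewrite normcN coef_map /= normc_int.
move=> E; have := ler_normc_sum (index_enum 'I_n) predT
  (fun i => (map_poly intr g)`_(bump 0 i) * z ^+ (bump 0 i)); rewrite -E => {E}.
apply/negP; rewrite -ltNge; apply: le_lt_trans dom.
rewrite big_add1 /= big_mkord; apply: ler_sum => i _.
rewrite /bump /= add1n normcM normcX coef_map /= normc_int.
by rewrite ler_wpM2l ?ler0z // lerXn2r ?nnegrE ?normc_ge0 ?(ltW B0).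
Qed.

End ComplexModulus.

Section RootSeparation.
Variable R : rcfType.
Implicit Types (z : R[i]) (f g h : {poly int}).

Local Notation toC f := (map_poly (intr : int -> R[i]) f).

Lemma complex_roots f : f != 0 -> exists s : seq R[i],
  [/\ size s = (size f).-1, forall x, x \in s -> (toC f).[x] = 0
    & forall z, normc (toC f).[z] =
        `|lead_coef f|%:~R * \prod_(x <- s) normc (z - x)].
Proof.
have I : injective (intr : int -> R[i]) by exact: intr_inj.
move=> f0; have [s sE] := closed_field_poly_normal (toC f).
have sm : size (toC f) = size f by rewrite (size_map_inj_poly I) ?rmorph0.
have F0 : toC f != 0 by rewrite -size_poly_eq0 sm size_poly_eq0.
exists s; split=> [|x xs|z]; first by rewrite (size_roots F0 sE) sm.
  by apply/rootP; rewrite sE rootZ ?lead_coef_eq0 // root_prod_XsubC.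
rewrite (horner_roots _ sE) normcM normc_prod.
by rewrite lead_coef_map_inj ?normc_int.
Qed.

(** If 2|z| <= B - A, then z is within (A + B)/2 of every root of f and farther
    than that from every root of g, so |M f(z)| < |N g(z)| and z is not a root
    of the combination. *)
Lemma lincomb_root_far n f g (M N : int) (A B : R) z : (0 < n)%N ->
  size f = n.+1 -> size g = n.+1 -> 0 < A ->
  `|M| * `|lead_coef f| < `|N| * `|lead_coef g| ->
  (forall x, (toC f).[x] = 0 -> normc x < A) ->
  (forall y, (toC g).[y] = 0 -> B < normc y) ->
  (toC (M *: f + N *: g)).[z] = 0 -> B - A < 2 * normc z.
Proof.
move=> n0 sf sg A0 MN fA gB; rewrite rmorphD /= !map_polyZ /= => /eqP.
rewrite hornerD !hornerZ addr_eq0 => /eqP /(congr1 (@normc R)).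
rewrite normcN !normcM !normc_int.
have [|s [ss fs ->]] := @complex_roots f; first by rewrite -size_poly_eq0 sf.
have [|t [st gt ->]] := @complex_roots g; first by rewrite -size_poly_eq0 sg.
move=> E; rewrite ltNge; apply/negP => zAB.
(* The midpoint of A and B separates the two families of distances. *)
pose c : R := (A + B) / 2.
have z0 := normc_ge0 z.
have c0 : 0 < c by rewrite /c; lra.
have Ps : \prod_(x <- s) normc (z - x) <= c ^+ n.
  rewrite -[n]/(n.+1.-1) -sf -ss; apply: ler_prod_seq => x /fs /fA xA.
  rewrite normc_ge0 /=; have := le_normcD z (- x); rewrite normcN /c; lra.
have Pt : c ^+ n < \prod_(y <- t) normc (z - y).
  rewrite -[n in c ^+ n]/(n.+1.-1) -sg -st; apply: ltr_prod_seq => [||y /gt/gB yB].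
  - exact: ltW.
  - by rewrite st sg.
  have := le_normcD z (y - z); rewrite normc_distC addrC subrK.
  rewrite normc_distC /c; lra.
move: E; rewrite !mulrA -!intrM => /eqP; apply/negP; rewrite lt_eqF //.
apply: (@le_lt_trans _ _ ((`|M| * `|lead_coef f|)%:~R * c ^+ n)).
  by rewrite ler_wpM2l // ler0z mulr_ge0.
apply: (@lt_trans _ _ ((`|N| * `|lead_coef g|)%:~R * c ^+ n)).
  by rewrite ltr_pM2r ?exprn_gt0 // ltr_int.
rewrite ltr_pM2l // ltr0z; apply: le_lt_trans MN; exact: mulr_ge0.
Qed.

(** Each value of f at a root of h is a product of n distances greater than c
    times a nonzero integer.  Since c >= 1, a single root of h is enough. *)
Lemma resultant_gt_of_far_roots n f h (c : R) : (0 < n)%N -> size f = n.+1 ->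
  (1 < size h)%N -> 1 <= c ->
  (forall x y, (toC f).[x] = 0 -> (toC h).[y] = 0 -> c < normc (y - x)) ->
  c ^+ n < `|resultant f h|%:~R.
Proof.
move=> n0 sf sh c1 far; have I : injective (intr : int -> R[i]) by exact: intr_inj.
have sm u : size (toC u) = size u by rewrite (size_map_inj_poly I) ?rmorph0.
have h0 : h != 0 by rewrite -size_poly_gt0 ltnW.
have f0 : f != 0 by rewrite -size_poly_eq0 sf.
have H0 : toC h != 0 by rewrite -size_poly_eq0 sm size_poly_eq0.
have lead_ge1 u : u != 0 -> 1 <= `|lead_coef u|%:~R :> R.
  by move=> u0; rewrite (ler_int _ 1) -gtz0_ge1 normr_gt0 lead_coef_eq0.
have [s [ss fs fE]] := complex_roots f0.
have [t tE] := closed_field_poly_normal (toC h).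
have ht y : y \in t -> (toC h).[y] = 0.
  by move=> yt; apply/rootP; rewrite tE rootZ ?lead_coef_eq0 // root_prod_XsubC.
have st : size t = (size h).-1 by rewrite (size_roots H0 tE) sm.
have fy y : y \in t -> c ^+ n < normc (toC f).[y].
  move=> /ht hy; rewrite fE; apply: (@lt_le_trans _ _ (\prod_(x <- s) normc (y - x))).
    rewrite -[n]/(n.+1.-1) -sf -ss; apply: ltr_prod_seq => [||x /fs fx].
    - exact: le_trans c1.
    - by rewrite ss sf.
    exact: far.
  by rewrite ler_peMl ?lead_ge1 // prodr_ge0 // => x _; apply: normc_ge0.
have [|e] := resultant_roots (p := toC f) _ tE H0; first by rewrite sm sf.
rewrite -resultant_intr => /(congr1 (@normc R)).
rewrite !normcM normc_sign mul1r normcX normc_prod normc_int lead_coef_map_inj //.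
rewrite normc_int => ->.
have cn1 : 1 <= c ^+ n by rewrite exprn_ege1.
apply: (@lt_le_trans _ _ (\prod_(y <- t) normc (toC f).[y])); last first.
  rewrite ler_peMl ?exprn_ege1 ?lead_ge1 // prodr_ge0 // => x _.
  exact: normc_ge0.
have st0 : (0 < size t)%N by rewrite st; case: (size h) sh => [|[]].
apply: (@le_lt_trans _ _ ((c ^+ n) ^+ size t)); first by rewrite ler_eXnr.
by apply: ltr_prod_seq => //; apply: le_trans cn1.
Qed.

End RootSeparation.

(** * The arithmetic of the factorisation *)

(** If p divides r1, then r2 divides k and cannot exceed it; the other case is
    symmetric. *)
Lemma prime_mul_no_large_factors (p k r1 r2 : nat) : prime p ->
  (r1 * r2 = p * k)%N -> (k < r1)%N -> (k < r2)%N -> False.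
Proof.
move=> pp; wlog /dvdnP[u ->] : r1 r2 / (p %| r1)%N => [wl E k1 k2|].
  have: (p %| r1 * r2)%N by rewrite E dvdn_mulr.
  rewrite Euclid_dvdM // => /orP[/(wl r1 r2)|/(wl r2 r1)]; apply=> //.
  by rewrite mulnC.
rewrite mulnAC mulnC => /eqP; rewrite eqn_pmul2l ?prime_gt0 // => /eqP <-.
case: u => [|u]; first by rewrite !mul0n.
by move=> _; rewrite ltnNge leq_pmull.
Qed.

Theorem theorem6p7 (R : realType) (n : nat) (a b : nat -> int)
    (f g : {poly int}) (p q : nat) (A B : R)
    (n_ge1 : (1 <= n)%N)
    (f_def : f = \poly_(i < n.+1) a i)
    (g_def : g = \poly_(i < n.+1) b i)
    (coef_neq0 : a 0%N * a n * b 0%N * b n != 0)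
    (p_prime : prime p)
    (q_gt0 : (0 < q)%N)
    (res_fg : `|resultant f g| = p%:Z * q%:Z)
    (A_gt0 : 0 < A)
    (B_gt0 : 0 < B)
    (AB : 3 * A + 2 * q%:R `^ n%:R^-1 <= B)
    (a_dom : \sum_(0 <= i < n) `|a i|%:~R * A ^ (i%:Z - n%:Z) < `|a n|%:~R)
    (b_dom : \sum_(1 <= i < n.+1) `|b i|%:~R * B ^+ i < `|b 0%N|%:~R) :
  forall M N : int,
    `|M|%:~R * (`|a n|%:~R / `|b n|%:~R) < `|N|%:~R :> R ->
    `|N|%:~R <= (B - 3 * A) / (2 * q%:R `^ n%:R^-1) ->
    irreducible_poly (map_poly (intr : int -> rat) (M *: f + N *: g)).
Proof.
move=> M N MN NB.
move: coef_neq0; rewrite !mulf_eq0 !negb_or -!andbA => /and4P[_ an0 _ bn0].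
have fc i : (i <= n)%N -> f`_i = a i by move=> h; rewrite f_def coef_poly ltnS h.
have gc i : (i <= n)%N -> g`_i = b i by move=> h; rewrite g_def coef_poly ltnS h.
have sf : size f = n.+1 by rewrite f_def size_poly_eq.
have sg : size g = n.+1 by rewrite g_def size_poly_eq.
have lf : lead_coef f = a n by rewrite lead_coefE sf fc.
have lg : lead_coef g = b n by rewrite lead_coefE sg gc.
have {}MN : `|M| * `|a n| < `|N| * `|b n|.
  move: MN; rewrite mulrA ltr_pdivrMr ?ltr0z ?normr_gt0 //.
  by rewrite -!intrM ltr_int.
have N0 : N != 0.
  by apply: contraTneq MN => ->; rewrite normr0 mul0r ltNge mulr_ge0.
have N1 : 1 <= `|N|%:~R :> R by rewrite (ler_int _ 1) -gtz0_ge1 normr_gt0.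
pose F := M *: f + N *: g.
have sF : size F = n.+1.
  apply/eqP; rewrite eqn_leq; apply/andP; split.
    rewrite (leq_trans (size_polyD _ _)) // geq_max -{1}sf -sg.
    by rewrite !size_scale_leq.
  rewrite ltnNge; apply/negP => /leq_sizeP/(_ n (leqnn n))/eqP; apply/negP.
  rewrite coefD !coefZ fc // gc // addr_eq0.
  by apply: contraTneq MN => E; rewrite -!normrM E normrN ltxx.
set s : R := q%:R `^ n%:R^-1 in AB NB.
have s_n : s ^+ n = q%:R.
  rewrite -powR_mulrn ?powR_ge0 // -powRrM mulVf ?powRr1 ?ler0n //.
  by rewrite pnatr_eq0 -lt0n.
have s1 : 1 <= s.
  by rewrite -(@ler_pXn2r _ n) ?nnegrE ?powR_ge0 // expr1n s_n ler1n.
have NsB : 2 * (`|N|%:~R * s) <= B - 3 * A.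
  move: NB; rewrite ler_pdivlMr; last by lra.
  by rewrite mulrCA.
have fA (x : R[i]) : (map_poly intr f).[x] = 0 -> normc x < A.
  apply: (@root_lt_of_lead_dominant _ n); rewrite ?sf // fc //.
  apply: le_lt_trans a_dom; rewrite !big_nat; apply: ler_sum => i /andP[_ lt].
  by rewrite fc // ltnW.
have gB (y : R[i]) : (map_poly intr g).[y] = 0 -> B < normc y.
  apply: (@root_gt_of_const_dominant _ n); rewrite ?sg // gc //.
  apply: le_lt_trans b_dom; rewrite !big_nat; apply: ler_sum => i /andP[_ lt].
  by rewrite gc.
pose c : R := `|N|%:~R * s.
have c_n : c ^+ n = (`|N| ^+ n * q%:Z)%:~R.
  by rewrite exprMn s_n rmorphM rmorphXn.
have c1 : 1 <= c by rewrite /c; nra.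
have factor_large (h k : {poly int}) : F = h * k -> (1 < size h)%N ->
    `|N| ^+ n * q%:Z < `|resultant f h|.
  move=> FE sh; rewrite -(ltr_int R) -c_n.
  apply: resultant_gt_of_far_roots => // x y fx hy.
  have : B - A < 2 * normc y.
    apply: (@lincomb_root_far _ n f g M N) => //; first by rewrite lf lg.
    by rewrite -/F FE rmorphM hornerM hy mul0r.
  have := fA _ fx; have := le_normcD (y - x) x; rewrite subrK /c; lra.
split; first by rewrite -/F size_rat_int_poly sF ltnS.
move=> u + /dvdpP_rat_int[h [d d0 uE] [k FE]].
rewrite -/F in FE *; rewrite {u}uE size_scale // size_rat_int_poly => h1.
have F0 : F != 0 by rewrite -size_poly_eq0 sF.
rewrite (eqp_trans (eqp_scale _ d0)) // FE.
have hk0 : h * k != 0 by rewrite -FE.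
have [h0 k0] : h != 0 /\ k != 0 by apply/andP; rewrite -negb_or -mulf_eq0.
have [/eqP/size_poly1P[e e0 ->]|k1] := eqVneq (size k) 1%N.
  by rewrite mulrC mul_polyC map_polyZ /= eqp_sym eqp_scale // intr_eq0.
have gt1 (v : {poly int}) : v != 0 -> size v != 1%N -> (1 < size v)%N.
  by move=> v0 v1; rewrite ltn_neqAle eq_sym v1 size_poly_gt0.
have := factor_large h k FE (gt1 _ h0 h1).
have := factor_large k h (etrans FE (mulrC _ _)) (gt1 _ k0 k1).
have := norm_resultantM (f := f) (g := h) (h := k); rewrite -FE sf => /(_ n_ge1 F0).
rewrite norm_resultant_lincomb ?sf ?sF ?sg //; last by rewrite -size_poly_eq0 sg.
rewrite res_fg /= mulrCA; set K := `|N| ^+ n * q%:Z => E k_lt h_lt.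
have KE : K = `|K|%N :> int by rewrite gez0_abs // mulr_ge0 // exprn_ge0.
case: (@prime_mul_no_large_factors p `|K|%N `|resultant f h|%N `|resultant f k|%N p_prime).
- by apply/eqP; rewrite -eqz_nat !PoszM -KE !abszE -E.
- by rewrite -ltz_nat -KE.
- by rewrite -ltz_nat -KE.
Qed.
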